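(* Let $\pi$ be a group, fix a degree $n\ge1$, and consider types of rigid Gauss diagrams on $\pi$ of degree $n$. 1. For any three types $1\prec2\prec3$ (each relation finer than the next), $\operatorname{T}_3^1=\operatorname{T}_3^2\circ\operatorname{T}_2^1:\mathfrak G_{(1)}\to\mathfrak G_{(3)}$ and $\operatorname{S}_3^1=\operatorname{S}_2^1\circ\operatorname{S}_3^2:\widehat{\mathfrak G_{(3)}}\to\widehat{\mathfrak G_{(1)}}$. 2. For any two types $1\prec2$, injections and projections are $\langle\,,\rangle$-adjoint: for all $\mathcal G_1\in\mathfrak G_{(1)}$ and $\mathcal G_2\in\widehat{\mathfrak G_{(2)}}$, $$\langle\operatorname{S}_2^1(\mathcal G_2),\mathcal G_1\rangle=\langle\mathcal G_2,\operatorname{T}_2^1(\mathcal G_1)\rangle .$$ 3. For any two types $1\prec2$, $\operatorname{Im}\operatorname{S}_2^1=\operatorname{Ker}^{\bot}\operatorname{T}_2^1$, where $\operatorname{Ker}^{\bot}\operatorname{T}_2^1$ is the set of elements of $\widehat{\mathfrak G_{(1)}}$ that are $\langle\,,\rangle$-orthogonal to the kernel of $\operatorname{T}_2^1$.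
   Context: A rigid Gauss diagram on $\pi$ of degree $n$ consists of the unit circle in $\mathbb C$ (oriented), a pairing of the $2n$-th roots of unity by $n$ oriented straight arrows, a sign $\pm1$ for each arrow and an element of $\pi$ on each of the $2n$ arcs of circle. The group $\mathbb Z/2n$ acts by rotations. A type of rigid Gauss diagrams is an equivalence relation on rigid Gauss diagrams on $\pi$ such that equivalent diagrams have the same degree (degree property) and the action of $\mathbb Z/2n$ on diagrams of degree $n$ induces an action on the degree $n$ equivalence classes (stability property). For a type $\sim$, a rigid diagram of type $\sim$ is an equivalence class, and a Gauss diagram of type $\sim$ is the orbit of such a class under $\mathbb Z/2n$. $\mathfrak G_\sim$ is the $\mathbb Q$-vector space freely generated by (degree $n$) Gauss diagrams of type $\sim$, and $\widehat{\mathfrak G_\sim}$ is the space of (possibly infinite) formal series of them. $\operatorname{Aut}(G)$ is the stabilizer in $\mathbb Z/2n$ of any rigid representative of $G$, and $\langle G,G'\rangle=|\operatorname{Aut}(G)|\,\delta_{G,G'}$, extended bilinearly when at least one argument is a finite sum. For types $1\prec 2$ (relation $1$ finer than relation $2$), the forgetful projection $\operatorname{T}_2^1:\mathfrak G_{(1)}\twoheadrightarrow\mathfrak G_{(2)}$ is the linear map sending the orbit of a $1$-class to the orbit of the $2$-class containing it. The symmetry-preserving injection $\operatorname{S}_2^1:\widehat{\mathfrak G_{(2)}}\hookrightarrow\widehat{\mathfrak G_{(1)}}$ is defined componentwise: $\operatorname{S}_2^1(G_2)$ is the formal sum, over all $1$-classes contained in a fixed rigid representative of $G_2$, of the $\mathbb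 Z/2n$-orbits of these $1$-classes (with multiplicity; this is well defined). *)

(* Defs.v *)
From mathcomp Require Import all_boot all_order all_algebra.
From mathcomp Require Import finmap.
From mathcomp Require Import boolp classical_sets functions cardinality fsbigop.
From mathcomp Require Import freeg.
From Stdlib Require Import RelationClasses.

Set Implicit Arguments.
Unset Strict Implicit.
Unset Printing Implicit Defensive.

Import GRing.Theory.
Local Open Scope ring_scope.
Local Open Scope classical_set_scope.
Local Open Scope quotient_scope.

Section RigidGaussDiagrams.
Variables (gT : groupType) (n : nat).

(* k in 'Z_(2 * n) stands for the root of unity exp(2 pi sqrt(-1) k / (2n));
   only meaningful for 0 < n, since 'Z_0 is Z/2. *)
Definition circpt := 'Z_(2 * n).

(* (tail, head, sign), the sign being +1 for true and -1 for false *)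
Definition arrow := (circpt * circpt * bool)%type.
Definition atail (a : arrow) : circpt := a.1.1.
Definition ahead (a : arrow) : circpt := a.1.2.

(* Every root of unity is an endpoint of exactly one arrow: for 0 < n there are
   then exactly n arrows. *)
Definition is_pairing (A : {set arrow}) : bool :=
  [forall a in A, atail a != ahead a] &&
  [forall i, #|[set a in A | (atail a == i) || (ahead a == i)]| == 1].

(* The function gives the decorations of the arcs: i indexes the arc going
   counterclockwise from the root i to the root i + 1. *)
Definition rdiag :=
  {D : {set arrow} * {ffun circpt -> gT} | is_pairing D.1}.

Definition rot_arrow (k : circpt) (a : arrow) : arrow :=
  (atail a + k, ahead a + k, a.2).

Definition rot_data (k : circpt) (D : {set arrow} * {ffun circpt -> gT}) :=
  ([set rot_arrow k a | a in D.1]%SET, [ffun i => D.2 (i - k)]).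

Lemma rot_arrowK k : cancel (rot_arrow k) (rot_arrow (- k)).
Proof. by case=> -[i j] s; rewrite /rot_arrow /atail /ahead /= !addrK. Qed.

Lemma rot_arrowVK k : cancel (rot_arrow (- k)) (rot_arrow k).
Proof. by case=> -[i j] s; rewrite /rot_arrow /atail /ahead /= !subrK. Qed.

Lemma rot_pairing k D : is_pairing D.1 -> is_pairing (rot_data k D).1.
Proof.
case: D => A f /= /andP[/forall_inP neA /forallP oneA]; apply/andP; split.
  apply/forall_inP => _ /imsetP[a aA ->].
  by rewrite /= (inj_eq (addIr k)); exact: neA.
have injr := can_inj (rot_arrowK k).
apply/forallP => i; rewrite -(eqP (oneA (i - k))); apply/eqP.
rewrite -[RHS](card_imset _ injr); apply/eq_card => a.
rewrite -[a](rot_arrowVK k); move: (rot_arrow (- k) a) => {}a.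
rewrite (finset.mem_imset _ _ injr) !inE (finset.mem_imset _ _ injr).
by rewrite /= ![_ == i - k]eq_sym !subr_eq ![i == _]eq_sym.
Qed.

Definition rotd (k : circpt) (D : rdiag) : rdiag :=
  exist _ (rot_data k (val D)) (rot_pairing k (valP D)).

Lemma rotd0 D : rotd 0 D = D.
Proof.
apply/val_inj; case: D => -[A f] /= pA; congr pair.
  rewrite -[RHS]imset_id; apply/eq_imset => -[[i j] s].
  by rewrite /rot_arrow /atail /ahead /= !addr0.
by apply/ffunP => i; rewrite ffunE subr0.
Qed.

Lemma rotdD k l D : rotd l (rotd k D) = rotd (k + l) D.
Proof.
apply/val_inj; case: D => -[A f] /= pA; congr pair => /=.
  rewrite -imset_comp; apply/eq_imset => -[[i j] s].
  by rewrite /rot_arrow /atail /ahead /= !addrA.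
by apply/ffunP => i; rewrite !ffunE -addrA -opprD [l + k]addrC.
Qed.

Record gtype := GType {
  trel : rdiag -> rdiag -> Prop;
  trel_equiv : Equivalence trel;
  trel_rot : forall k D D', trel D D' -> trel (rotd k D) (rotd k D') }.

Definition finer (t1 t2 : gtype) := forall D D', trel t1 D D' -> trel t2 D D'.

Section OneType.
Variable t : gtype.

Definition brel : rel rdiag := fun D D' => `[< trel t D D' >].

Lemma brel_refl : reflexive brel.
Proof. by move=> D; apply/asboolP; case: (trel_equiv t). Qed.

Lemma brel_sym : symmetric brel.
Proof.
case: (trel_equiv t) => _ s _ D D'.
by apply/asboolP/asboolP; exact: s.
Qed.

Lemma brel_trans : transitive brel.
Proof.
case: (trel_equiv t) => _ _ s D2 D1 D3 /asboolP h12 /asboolP h23.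
by apply/asboolP; exact: s h12 h23.
Qed.

Canonical brel_equiv := EquivRel brel brel_refl brel_sym brel_trans.

Definition rclass := {eq_quot brel}.

Definition cls (D : rdiag) : rclass := \pi_rclass D.

Definition rotc (k : circpt) (x : rclass) : rclass := cls (rotd k (repr x)).

Lemma rotc_cls k D : rotc k (cls D) = cls (rotd k D).
Proof.
apply/eqmodP/asboolP/trel_rot/asboolP.
by apply: (introT (eqmodP brel_equiv _ D)); rewrite reprK.
Qed.

Lemma rotc0 x : rotc 0 x = x.
Proof. by rewrite /rotc rotd0 /cls reprK. Qed.

Lemma rotcD k l x : rotc l (rotc k x) = rotc (k + l) x.
Proof. by rewrite [rotc k x]/rotc rotc_cls rotdD. Qed.

Definition orel : rel rclass := fun x y => [exists k, rotc k x == y].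

Lemma orel_refl : reflexive orel.
Proof. by move=> x; apply/existsP; exists 0; rewrite rotc0. Qed.

Lemma orel_sym : symmetric orel.
Proof.
move=> x y; apply/existsP/existsP => -[k /eqP<-];
by exists (- k); rewrite rotcD subrr rotc0.
Qed.

Lemma orel_trans : transitive orel.
Proof.
move=> y x z /existsP[k /eqP<-] /existsP[l /eqP<-].
by apply/existsP; exists (k + l); rewrite rotcD.
Qed.

Canonical orel_equiv := EquivRel orel orel_refl orel_sym orel_trans.

Definition gauss := {eq_quot orel}.

Definition orb (x : rclass) : gauss := \pi_gauss x.

Definition gAut (G : gauss) : {set circpt} :=
  [set k | rotc k (repr G) == repr G]%SET.

(* Finite, resp. possibly infinite, formal sums of Gauss diagrams. *)
Definition gsums := {freeg gauss / rat}.
Definition gseries := gauss -> rat.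

Definition to_series (y : gsums) : gseries := fun G => coeff G y.

Definition bracket (G G' : gauss) : rat := #|gAut G|%:R * (G == G')%:R.

(* A sum over i \in setT ranges over the support of the summand; here it is
   finite as soon as x or y has finite support, and the value of the pairing is
   irrelevant otherwise. *)
Definition pairing (x y : gseries) : rat :=
  \sum_(G \in [set: gauss]) \sum_(G' \in [set: gauss])
     x G * y G' * bracket G G'.

End OneType.

Section TwoTypes.
Variables t1 t2 : gtype.

(* When t1 is finer than t2, this is the t2-class containing x. *)
Definition superclass (x : rclass t1) : rclass t2 := cls t2 (repr x).

Definition Tproj : gsums t1 -> gsums t2 :=
  fglift (fun G : gauss t1 => << orb (superclass (repr G)) >> : gsums t2).

(* The t1-classes contained in y, where D belongs to x iff cls t D = x. *)
Definition subclasses (y : rclass t2) : set (rclass t1) :=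
  [set x | forall D, cls t1 D = x -> cls t2 D = y].

(* The coefficient of G1 in the formal sum of the orbits of the t1-classes
   contained in repr G2; orbits being finite, so is the support of the sum. *)
Definition Sinj_gauss (G2 : gauss t2) : gseries t1 := fun G1 =>
  \sum_(x \in subclasses (repr G2)) ((orb x == G1)%:R : rat).

(* For each G1, at most one term is nonzero when t1 is finer than t2. *)
Definition Sinj (z : gseries t2) : gseries t1 := fun G1 =>
  \sum_(G2 \in [set: gauss t2]) z G2 * Sinj_gauss G2 G1.

Definition kerT : set (gsums t1) := [set y | Tproj y = 0].

Definition kerT_orth : set (gseries t1) :=
  [set x | forall y, kerT y -> pairing x (to_series y) = 0].

End TwoTypes.
End RigidGaussDiagrams.

Arguments Tproj {gT n} t1 t2 _.
Arguments Sinj {gT n} t1 t2 _.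
Arguments kerT {gT n} t1 t2 _.
Arguments kerT_orth {gT n} t1 t2 _.

(* Main.v *)
(** The inclusion of 1-classes into 2-classes is equivariant under rotations, so
    it induces a surjection [gproj] from Gauss diagrams of type 1 to those of type
    2; T is its linear extension.  By the orbit-stabilizer theorem, the stabilizer
    of a 2-class acts on the 1-classes it contains, so that
      [S z G = z (gproj G) * |Aut (gproj G)| / |Aut G|].
    Functoriality of S and T is then that of [gproj], and adjointness is a weighted
    change of variables.  A series f orthogonal to all [<< G >> - << G' >>] with
    [gproj G = gproj G'] is such that [f G * |Aut G|] depends only on [gproj G],
    hence is of the form [S z]. *)
From HB Require Import structures.
Require Import Defs.
From mathcomp Require Import all_boot all_order all_algebra.
From mathcomp Require Import finmap.
From mathcomp Require Import boolp classical_sets functions.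
From mathcomp Require Import cardinality fsbigop freeg.
Set Implicit Arguments.
Unset Strict Implicit.
Unset Printing Implicit Defensive.
Local Open Scope classical_set_scope.

(** * Linear extension of maps defined on a basis *)

Section FreeModule.
Import GRing.Theory.
Local Open Scope ring_scope.
Variable R : nzRingType.

Lemma fgliftE (M : lmodType R) (K : choiceType) (f : K -> M) (y : {freeg K / R}) :
  fglift f y = \sum_(k <- dom y) coeff k y *: f k.
Proof. by rewrite -{1}(Freeg_dom y) fglift_Freeg /prelift big_map. Qed.

HB.instance Definition _ (M : lmodType R) (K : choiceType) (f : K -> M) :=
  GRing.isZmodMorphism.Build {freeg K / R} M (fglift f) (lift_is_additive f).

Lemma fglift1 (M : lmodType R) (K : choiceType) (f : K -> M) (k : K) :
  fglift f << k >> = f k.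
Proof. by rewrite liftU scale1r. Qed.

Lemma freegZ (K : choiceType) (c : R) (k : K) :
  c *: << k >> = << c *g k >> :> {freeg K / R}.
Proof. by apply/eqP/freeg_eqP => l; rewrite coeffZ !coeffU mul1r. Qed.

Lemma fglift_comp (M : lmodType R) (K L : choiceType) (f : L -> M) (h : K -> L)
    (y : {freeg K / R}) :
  fglift f (fglift (fun k => << h k >> : {freeg L / R}) y) = fglift (f \o h) y.
Proof.
rewrite [X in fglift f X]fgliftE raddf_sum [RHS]fgliftE.
by apply: eq_bigr => k _; rewrite freegZ /= liftU.
Qed.

End FreeModule.

(** * Stabilizers and fibers of equivariant maps *)

Section OrbitCounting.
Import GRing.Theory.
Local Open Scope ring_scope.
Variables (Z : finZmodType) (X Y : choiceType).

Definition stab (T : choiceType) (a : Z -> T -> T) (x : T) : {set Z} :=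
  [set k | a k x == x]%SET.

Variables (a : Z -> X -> X) (b : Z -> Y -> Y) (p : X -> Y).
Hypothesis a0 : forall x, a 0 x = x.
Hypothesis aD : forall k l x, a l (a k x) = a (k + l) x.
Hypothesis pa : forall k x, p (a k x) = b k (p x).

Lemma act_inj k : injective (a k).
Proof. by move=> x y /(congr1 (a (- k))); rewrite !aD subrr !a0. Qed.

(** The acting group is commutative, so conjugating a stabilizer does not change it. *)
Lemma stab_act k x : stab a (a k x) = stab a x.
Proof. by apply/setP => l; rewrite !inE aD addrC -aD (inj_eq (@act_inj k)). Qed.

(** The elements sending [x] to [x'] form the translate of [stab a x] by [k]. *)
Lemma card_act_eq x x' k :
  a k x = x' -> #|[set l | a l x == x']%SET| = #|stab a x|.
Proof.
move=> <-; rewrite -[RHS](card_imset _ (addIr k)); apply: eq_card => l.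
rewrite inE; apply/eqP/imsetP => [lk|[m /[!inE] /eqP xm ->]].
  by exists (l - k); rewrite ?subrK // inE -aD lk aD subrr a0.
by rewrite -aD xm.
Qed.

(* Orbit-stabilizer: the stabilizer of [p x] acts transitively on the points of
   the orbit of x above [p x], with point stabilizer [stab a x]. *)
Lemma card_stab_fiber x (A : set X) (o : pred X) :
    (forall x', A x' <-> p x' = p x) ->
    (forall x', reflect (exists k, x' = a k x) (o x')) ->
  #|stab b (p x)|%:R =
  (\sum_(x' \in A) ((o x')%:R : rat)) * #|stab a x|%:R.
Proof.
move=> AE oP; set S := stab b _; pose r := undup [seq a k x | k <- enum S].
have mem_r x' : (x' \in r) = (p x' == p x) && o x'.
  rewrite mem_undup; apply/mapP/andP.
    case=> k; rewrite mem_enum inE => /eqP kS ->; rewrite pa kS eqxx; split=> //.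
    by apply/oP; exists k.
  by case=> /eqP x'x /oP[k kx']; exists k => //; rewrite mem_enum inE -pa -kx' x'x.
rewrite (fsbigE r) ?undup_uniq //; last 2 first.
- by move=> x' /=; rewrite mem_r => /andP[/eqP /AE].
- by move=> x' /AE x'x; rewrite mem_r x'x eqxx /= => /negPf->.
rewrite big_seq_cond mulr_suml -big_seq_cond -sum1_card natr_sum.
(* Double counting: each [k] in [S] sends [x] to exactly one point of [r]. *)
rewrite (eq_bigr (fun k => \sum_(x' <- r) (a k x == x')%:R)) => [|k]; last first.
  rewrite inE => /eqP kS; have kr : a k x \in r.
    by rewrite mem_r pa kS eqxx; apply/oP; exists k.
  rewrite (perm_big _ (perm_to_rem kr)) big_cons eqxx big1_seq ?addr0 // => x'.
  by rewrite (mem_rem_uniq _ (undup_uniq _)) inE eq_sym => /and3P[_ /negPf->].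
rewrite exchange_big /= [RHS]big_mkcond /=; apply: eq_big_seq => x'.
rewrite mem_r => /andP[/eqP x'x xx']; rewrite (mem_set (proj2 (AE _) x'x)).
rewrite xx' mul1r.
(* Any [l] with [a l x = x'] fixes [p x] because [p x' = p x], so restricting to [S] loses nothing
   and the inner sum counts a full coset. *)
have /oP[k kx'] := xx'; rewrite -(card_act_eq (esym kx')).
rewrite -natr_sum -sum1_card big_mkcond [in RHS]big_mkcond; congr _%:R.
apply: eq_bigr => l _; rewrite !inE -pa.
by have [->|_] := eqVneq (a l x) x'; [rewrite x'x eqxx | case: ifP].
Qed.

End OrbitCounting.

Section GaussDiagrams.
Import GRing.Theory Num.Theory.
Local Open Scope ring_scope.
Local Open Scope quotient_scope.
Variables (gT : groupType) (n : nat).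
Implicit Types t : gtype gT n.

(** * Automorphism counts and the pairing for a single type *)

Section OneType.
Variable t : gtype gT n.
Implicit Types (x : rclass t) (G : gauss t) (f : gseries t).

Lemma cls_repr x : cls t (repr x) = x.
Proof. by rewrite /cls reprK. Qed.

Lemma orb_repr G : orb (repr G) = G.
Proof. by rewrite /orb reprK. Qed.

Lemma eq_orbP x y : reflect (exists k, y = rotc k x) (orb x == orb y).
Proof.
apply: (iffP eqP) => [/eqmodP/existsP[k /eqP<-]|[k ->]]; first by exists k.
by apply/eqmodP/existsP; exists k.
Qed.

Definition naut G : rat := #|gAut G|%:R.

Lemma naut_orb x : naut (orb x) = #|stab (@rotc _ _ t) x|%:R.
Proof.
have /eqP/eq_orbP[k xE] := orb_repr (orb x).
by rewrite [in RHS]xE (stab_act (@rotc0 _ _ t) (@rotcD _ _ t)).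
Qed.

Lemma naut_neq0 G : naut G != 0.
Proof.
by rewrite pnatr_eq0 -lt0n; apply/card_gt0P; exists 0; rewrite inE rotc0.
Qed.

(** The bracket is diagonal and [y] has finite support, so the double sum collapses to a linear form
    in [y]; [rat^o] is the field as a module over itself. *)
Lemma pairingE f (y : gsums t) :
  pairing f (to_series y) = fglift (fun G => f G * naut G : rat^o) y.
Proof.
rewrite fgliftE /pairing (@eq_fsbigr _ _ _ _ _
    (fun G => coeff G y * (f G * naut G))) => [|G _]; last first.
  rewrite (fsbigTE [fset G]%fset) => [|G' /[!inE] neG]; last first.
    by rewrite /bracket eq_sym (negPf neG) !mulr0.
  by rewrite big_seq_fset1 /bracket eqxx mulr1 -mulrA mulrCA mulrA.
rewrite (fsbigE (dom y)) ?uniq_dom //.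
  by apply: eq_bigl => G; rewrite in_setT.
by move=> G _ /coeff_outdom->; rewrite mul0r.
Qed.

End OneType.

(** * Projection and injection for two nested types *)

Section TwoTypes.
Variables t1 t2 : gtype gT n.
Hypothesis t12 : finer t1 t2.
Implicit Types (x : rclass t1) (G : gauss t1).

(** Fineness makes [superclass] independent of the representative chosen by [repr]. *)
Lemma superclass_cls (D : rdiag gT n) : superclass t2 (cls t1 D) = cls t2 D.
Proof.
apply/eqmodP/asboolP/t12/asboolP.
by apply: (introT (eqmodP (brel_equiv t1) _ D)); rewrite reprK.
Qed.

Lemma superclass_rotc k x :
  superclass t2 (rotc k x) = rotc k (superclass t2 x).
Proof. by rewrite -[x]cls_repr !(rotc_cls, superclass_cls). Qed.

Lemma subclassesE (y : rclass t2) x : subclasses y x <-> superclass t2 x = y.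
Proof.
split=> [yx|<- D <-]; first exact/yx/cls_repr.
by rewrite superclass_cls.
Qed.

Definition gproj G : gauss t2 := orb (superclass t2 (repr G)).

Lemma gproj_orb x : gproj (orb x) = orb (superclass t2 x).
Proof.
rewrite /gproj; have /eqP/eq_orbP[k ->] := esym (orb_repr (orb x)).
by apply/eqP/eq_orbP; exists (- k); rewrite superclass_rotc rotcD subrr rotc0.
Qed.

Lemma Sinj_gauss_eq0 (G2 : gauss t2) G :
  gproj G <> G2 -> Sinj_gauss G2 G = 0.
Proof.
move=> neG; apply: fsbig1 => x /subclassesE xG2.
have [xG|//] := eqVneq (orb x) G; case: neG.
by rewrite -xG gproj_orb xG2 orb_repr.
Qed.

Lemma naut_superclass x :
  naut (orb (superclass t2 x)) =
  (\sum_(x' \in subclasses (superclass t2 x)) ((orb x' == orb x)%:R : rat))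
    * naut (orb x).
Proof.
apply: etrans (naut_orb _) _; rewrite (naut_orb x).
apply: (card_stab_fiber (@rotc0 _ _ t1) (@rotcD _ _ t1) superclass_rotc).
  by move=> x'; exact: subclassesE.
by move=> x'; rewrite eq_sym; exact: eq_orbP.
Qed.

Lemma Sinj_gauss_gproj G : Sinj_gauss (gproj G) G = naut (gproj G) / naut G.
Proof.
(* The chosen representative of [G] lies above [repr (gproj G)] only up to a rotation, which is
   applied here. *)
have [x xG xy] : exists2 x, orb x = G & superclass t2 x = repr (gproj G).
  have /eqP/eq_orbP[k kG] := esym (orb_repr (gproj G)).
  exists (rotc k (repr G)); last by rewrite superclass_rotc -kG.
  by rewrite -[RHS]orb_repr; apply/esym/eqP/eq_orbP; exists k.
have yG : orb (superclass t2 x) = gproj G by rewrite xy orb_repr.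
have := naut_superclass x; rewrite yG xG => ->; rewrite mulfK ?naut_neq0 //.
by rewrite xy.
Qed.

Lemma SinjE (z : gseries t2) G :
  Sinj t1 t2 z G = z (gproj G) * naut (gproj G) / naut G.
Proof.
rewrite /Sinj (fsbigTE [fset gproj G]%fset) => [|G2 /[!inE] neG]; last first.
  by rewrite Sinj_gauss_eq0 ?mulr0 // => GG2; rewrite GG2 eqxx in neG.
by rewrite big_seq_fset1 Sinj_gauss_gproj mulrA.
Qed.

Lemma gproj_surj (G2 : gauss t2) : exists G, gproj G = G2.
Proof.
exists (orb (cls t1 (repr (repr G2)))).
by rewrite gproj_orb superclass_cls cls_repr orb_repr.
Qed.

Lemma fglift_Tproj (f : gauss t2 -> rat^o) (y : gsums t1) :
  fglift f (Tproj t1 t2 y) = fglift (f \o gproj) y.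
Proof. exact: fglift_comp. Qed.

(** The factor [naut G] of the pairing cancels the denominator in [SinjE], leaving the linear
    extension of a function of [gproj G]. *)
Lemma pairing_Sinj (x1 : gsums t1) (x2 : gseries t2) :
  pairing (Sinj t1 t2 x2) (to_series x1) =
  pairing x2 (to_series (Tproj t1 t2 x1)).
Proof.
rewrite (pairingE (Sinj t1 t2 x2)) pairingE [RHS]fglift_Tproj.
apply: (congr1 (fun f : gauss t1 -> rat^o => fglift f x1)).
by apply/funext => G /=; rewrite SinjE divfK ?naut_neq0.
Qed.

Lemma range_Sinj : range (Sinj t1 t2) = kerT_orth t1 t2.
Proof.
apply/seteqP; split=> [_ [z _ <-] y kery | f fK].
  by rewrite pairing_Sinj kery pairingE raddf0.
have f_const G G' : gproj G = gproj G' -> f G * naut G = f G' * naut G'.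
  (* Two diagrams with the same projection differ by an element of the kernel, to which
     orthogonality applies. *)
  move=> GG'; have /fK : kerT t1 t2 (<< G >> - << G' >>).
    rewrite /kerT /= /Tproj raddfB /= !fglift1 -/(gproj G) -/(gproj G') GG'.
    exact: subrr.
  by rewrite pairingE raddfB /= !fglift1 => /subr0_eq.
have [s sK] : {s : gauss t2 -> gauss t1 & cancel s gproj} := choice gproj_surj.
(* This preimage solves the formula of [SinjE] for [z]; by [f_const] the choice of the section [s]
   is immaterial. *)
exists (fun G2 : gauss t2 => f (s G2) * naut (s G2) / naut G2); first exact: I.
apply/funext => G; rewrite SinjE divfK ?naut_neq0 //.
by rewrite (f_const _ G (sK _)) mulfK ?naut_neq0.
Qed.

End TwoTypes.

(** * Functoriality along three nested types *)

Lemma gproj_comp t1 t2 t3 : finer t1 t2 -> finer t2 t3 ->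
  @gproj t1 t3 = @gproj t2 t3 \o @gproj t1 t2.
Proof.
move=> t12 t23; apply/funext => G /=; rewrite gproj_orb //; congr orb.
by rewrite -{2}(cls_repr (repr G)) !superclass_cls.
Qed.

Lemma Tproj_comp t1 t2 t3 : finer t1 t2 -> finer t2 t3 ->
  Tproj t1 t3 = Tproj t2 t3 \o Tproj t1 t2.
Proof.
move=> t12 t23; apply/funext => y /=.
rewrite [in RHS]/Tproj fglift_comp; congr (fglift _ y); apply/funext => G /=.
by rewrite -/(gproj t3 G) (gproj_comp t12 t23).
Qed.

Lemma Sinj_comp t1 t2 t3 : finer t1 t2 -> finer t2 t3 ->
  Sinj t1 t3 = Sinj t1 t2 \o Sinj t2 t3.
Proof.
move=> t12 t23; apply/funext => z; apply/funext => G /=.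
have t13 : finer t1 t3 by move=> D D' /t12/t23.
(* Explicit terms: comparing [gauss t1] with [gauss t2] makes unification diverge. *)
apply: etrans (SinjE t13 z G) _; apply: etrans _ (esym (SinjE t12 _ G)).
rewrite (SinjE t23) (divfK (naut_neq0 (gproj t2 G))).
by rewrite (gproj_comp t12 t23).
Qed.

End GaussDiagrams.

Theorem proposition4p6 (gT : groupType) (n : nat) (n_gt0 : (0 < n)%N) :
  [/\ forall t1 t2 t3 : gtype gT n, finer t1 t2 -> finer t2 t3 ->
        Tproj t1 t3 = Tproj t2 t3 \o Tproj t1 t2 /\
        Sinj t1 t3 = Sinj t1 t2 \o Sinj t2 t3,
      forall t1 t2 : gtype gT n, finer t1 t2 ->
        forall (x1 : gsums t1) (x2 : gseries t2),
          pairing (Sinj t1 t2 x2) (to_series x1) =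
          pairing x2 (to_series (Tproj t1 t2 x1))
    & forall t1 t2 : gtype gT n, finer t1 t2 ->
        range (Sinj t1 t2) = kerT_orth t1 t2].
Proof.
split=> [t1 t2 t3 t12 t23|t1 t2 t12 x1 x2|t1 t2 t12].
- by split; [exact: Tproj_comp | exact: Sinj_comp].
- exact: pairing_Sinj.
- exact: range_Sinj.
Qed.
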